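(* Let $\Delta$ be a $d$-dimensional flag-no-square simplicial complex with no free $(d-1)$-faces. Then, if $(f_{-1},f_0,\ldots,f_d)$ is the $f$-vector of $\Delta$, \[ f_d> (25/12)^{2^{d-2}} \qquad\text{and}\qquad f_0>(25/12)^{2^{d-3}}. \]
   Context: Simplicial complexes are finite and have at least one vertex (so $d\geq 0$). The $f$-vector entry $f_i$ is the number of $i$-dimensional faces of $\Delta$. A simplicial complex is flag if every set of vertices that are pairwise joined by edges is a face (equivalently, it is the independence complex of a finite simple graph, i.e. the complex whose faces are the sets of pairwise non-adjacent vertices). A flag simplicial complex is flag-no-square if it has no induced 4-cycles, i.e. there is no set of four vertices on which the induced subcomplex is a 4-cycle (a square without diagonals). A facet is a face that is maximal under inclusion. A $(d-1)$-face (codimension 1 face) of the $d$-dimensional complex $\Delta$ is free if it is contained in only one facet of $\Delta$. *)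

(* Defs.v *)
From mathcomp Require Import all_boot all_order all_algebra.
From mathcomp Require Import reals exp.

Set Implicit Arguments.
Unset Strict Implicit.
Unset Printing Implicit Defensive.

Import Order.TTheory GRing.Theory Num.Theory.
Local Open Scope ring_scope.

(* The faces are subsets of an ambient finite type T. A point x of T is a vertex
   only if [set x] is a face, so T may contain points that are not vertices.
   The empty face always belongs to the complex, by the last two fields. *)
Record simplicial_complex (T : finType) := SimplicialComplex {
  faces : {set {set T}};
  faces_down_closed :
    forall F G : {set T}, F \in faces -> G \subset F -> G \in faces;
  faces_vertex : exists x : T, [set x] \in faces
}.

Section Complexes.
Variables (T : finType) (D : simplicial_complex T).
Implicit Types (F W : {set T}) (i : int).

Definition vertices : {set T} := [set x | [set x] \in faces D].

(* Dimensions are integers: the empty face has dimension -1. *)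
Definition face_dim F : int := #|F|%:Z - 1.

Definition complex_dim : int := (\max_(F in faces D) #|F|)%N%:Z - 1.

Definition f_vector i : nat := #|[set F in faces D | face_dim F == i]|.

Definition flag : Prop :=
  forall W, W \subset vertices ->
    (forall x y, x \in W -> y \in W -> x != y -> [set x; y] \in faces D) ->
    W \in faces D.

Definition induced W : {set {set T}} := [set F in faces D | F \subset W].

Definition four_cycle (a b c e : T) : {set {set T}} :=
  [set set0; [set a]; [set b]; [set c]; [set e];
       [set a; b]; [set b; c]; [set c; e]; [set e; a]].

Definition flag_no_square : Prop :=
  flag /\
  ~ (exists a b c e : T,
       uniq [:: a; b; c; e] /\ induced [set a; b; c; e] = four_cycle a b c e).

Definition facets : {set {set T}} :=
  [set F | maxset [pred G | G \in faces D] F].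

(* A codimension 1 face that is itself a facet lies in exactly one facet,
   hence it is free. *)
Definition free_face F : bool :=
  [&& F \in faces D, face_dim F == complex_dim - 1
    & #|[set G in facets | F \subset G]| == 1%N].

End Complexes.

(* Main.v *)
Require Import Defs.
From mathcomp Require Import all_boot all_order all_algebra.
From mathcomp Require Import reals exp.
From mathcomp Require Import zify lra.
Import Order.TTheory GRing.Theory Num.Theory.
Local Open Scope ring_scope.

(** Two non-adjacent vertices of a flag complex without squares have a clique as
    common neighbourhood.  So the facets of a vertex link force many vertices
    outside of it, and the number of facets is roughly squared each time that the
    dimension grows by one.

    For a face s, let x(s) be the number of d-faces containing s, and y(s) the
    number of vertices outside s of these d-faces; when s lies in a d-face they
    are the numbers of top faces of the link of s, and of vertices of these top
    faces.  Say that s has level m if d - #|s| = m, so that its link has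
    dimension m.  Then:
    - at level 0, s is a ridge; as it is not free, x(s) = y(s) >= 2
      ([link_growth0]);
    - for a vertex v of the link, each d-face F containing v |: s meets
      another d-face w |: (F :\ v) along F :\ v.  The vertex w is not
      adjacent to v by flagness, and F is determined by w: all vertices of F
      other than v are common neighbours of v and w, so two such F would span
      one clique.
      Hence y(s) >= x(v |: s) + y(v |: s) + 1 ([tops_link_vertices_growth]);
    - counting pairs (v, F) with v in F and not in s gives
      (m + 1) x(s) = sum over v of x(v |: s) ([sum_tops_link]).

    Uniform lower bounds x_m, y_m at level m thus satisfy
    y_(m+1) = x_m + y_m + 1 and (m + 2) x_(m+1) = x_m y_(m+1).  They start
    with (2, 2), (5, 5), (55/3, 11).  From level 2 on,
    x_(m+1) >= x_m ^ 2 / (m + 2) suffices, and yields x_m >= (m + 3) (25/12) ^ (2 ^ (m - 2)) because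
    (m + 3) ^ 2 >= (m + 2) (m + 4).  The theorem is the case s = set0, of
    level d; its bound on f_0 follows from y_d > x_(d-1) when d >= 3. *)

Section FlagNoSquare.
Local Set Implicit Arguments.
Local Unset Strict Implicit.
Local Unset Printing Implicit Defensive.
Variables (T : finType) (D : simplicial_complex T).
Local Open Scope nat_scope.
Implicit Types (F G s : {set T}) (a b c e v w x y : T) (n : nat).

(** * Adjacency and cliques *)

(** Reflexive on the vertices, so that a clique is a set whose elements are
    pairwise adjacent, without a distinctness condition. *)
Definition adj x y : bool := [set x; y] \in faces D.

Lemma adj_sym x y : adj x y = adj y x.
Proof. by rewrite /adj setUC. Qed.

Lemma adj_refl x y : adj x y -> adj x x.
Proof. by move/faces_down_closed; apply; rewrite setUid sub1set set21. Qed.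

Lemma face_adj F x y : F \in faces D -> x \in F -> y \in F -> adj x y.
Proof.
by move=> FD xF yF; apply: faces_down_closed FD _; rewrite subUset !sub1set xF.
Qed.

Lemma clique_face F :
  flag D -> (forall x y, x \in F -> y \in F -> adj x y) -> F \in faces D.
Proof.
move=> flagD adjF; apply: flagD => [|x y xF yF _]; last exact: adjF.
by apply/subsetP=> x xF; rewrite inE; have := adjF x x xF xF; rewrite /adj setUid.
Qed.

(** Otherwise a, b, c, e is a square without diagonals. *)
Lemma common_neighbors_adj a b c e :
  flag_no_square D -> ~~ adj a c ->
  adj a b -> adj c b -> adj a e -> adj c e -> adj b e.
Proof.
case=> flagD nosq nac ab cb ae ce; apply/negPn/negP => nbe; apply: nosq.
have nab : a != b by apply: contraNneq nac => ->; rewrite adj_sym.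
have nae : a != e by apply: contraNneq nac => ->; rewrite adj_sym.
have ncb : c != b by apply: contraNneq nac => ->.
have nce : c != e by apply: contraNneq nac => ->.
have nc : a != c by apply: contraNneq nac => <-; apply: adj_refl ab.
have nb : b != e.
  by apply: contraNneq nbe => <-; rewrite adj_sym in ab; apply: adj_refl ab.
exists a, b, c, e; split.
  by rewrite /= !inE !negb_or nab nc nae eq_sym ncb nb nce.
(* A face among the four points contains neither diagonal; this leaves nine
   subsets, the faces of the 4-cycle. *)
apply/setP=> F; rewrite [in LHS]inE; apply/andP/idP => [[FD Fs]|].
  have nacF : ~~ ((a \in F) && (c \in F)).
    by apply: contra nac => /andP[? ?]; apply: face_adj FD _ _.
  have nbeF : ~~ ((b \in F) && (e \in F)).
    by apply: contra nbe => /andP[? ?]; apply: face_adj FD _ _.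
  have defF : F = [set x | [|| (x == a) && (a \in F), (x == b) && (b \in F),
                             (x == c) && (c \in F) | (x == e) && (e \in F)]].
    apply/setP=> x; rewrite inE; apply/idP/idP=> [xF|].
      have := subsetP Fs x xF; rewrite !inE -!orbA.
      by case/or4P=> /eqP E; rewrite -E xF eqxx ?orbT.
    by case/or4P=> /andP[/eqP->].
  rewrite defF /four_cycle !inE -!orbA.
  case: (a \in F) (b \in F) (c \in F) (e \in F) nacF nbeF => [] [] [] [] //= _ _.
  all: repeat first [apply/orP; left; by apply/eqP/setP=> x; rewrite !inE;
    case: (x == a); case: (x == b); case: (x == c); case: (x == e)
   | by apply/eqP/setP=> x; rewrite !inE;
    case: (x == a); case: (x == b); case: (x == c); case: (x == e)
   | apply/orP; right].
have ba := ab; rewrite adj_sym in ba.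
have ea := ae; rewrite adj_sym in ea.
have bc := cb; rewrite adj_sym in bc.
have f1 x y : adj x y -> [set x] \in faces D.
  by move/adj_refl; rewrite /adj setUid.
have f0 : set0 \in faces D := faces_down_closed ab (sub0set _).
rewrite /four_cycle !inE -!orbA.
do 8?[case/orP]; move/eqP->; split;
  rewrite ?(subUset, sub1set, sub0set, inE, eqxx, orbT) //.
all: solve [exact: f1 ab | exact: f1 bc | exact: f1 ce | exact: f1 ea].
Qed.

(** * Top faces around a face *)

(** The top faces of the link of s are encoded by the faces of D that contain s:
    an induction over links then stays inside D.  The cardinality n is to be
    d + 1, as for the d-faces. *)
Definition tops n s : {set {set T}} :=
  [set F in faces D | (#|F| == n) && (s \subset F)].

Definition tops_link_vertices n s : {set T} :=
  [set v | (v \notin s) && (tops n (v |: s) != set0)].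

Lemma topsP n s F :
  reflect [/\ F \in faces D, #|F| = n & s \subset F] (F \in tops n s).
Proof.
rewrite inE; apply: (iffP and3P) => [] [? E ?]; split=> //; exact/eqP.
Qed.

Lemma tops_link_verticesP n s v :
  reflect (v \notin s /\ exists2 F, F \in tops n s & v \in F)
          (v \in tops_link_vertices n s).
Proof.
rewrite inE; apply: (iffP andP) => -[vs].
  case/set0Pn=> F /topsP[FD Fn]; rewrite subUset sub1set => /andP[vF sF].
  by split=> //; exists F => //; apply/topsP.
case=> F /topsP[FD Fn sF] vF; split=> //; apply/set0Pn; exists F.
by apply/topsP; split; rewrite // subUset sub1set vF.
Qed.

Lemma tops_setU1 n s v F : (F \in tops n (v |: s)) = (F \in tops n s) && (v \in F).
Proof. by rewrite !inE subUset sub1set; case: (v \in F); rewrite ?andbF ?andbT. Qed.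

(** * The opposite vertex across a ridge *)

(** The ridge F :\ v lies in a second top face w |: (F :\ v).  If w were adjacent
    to v, then w |: F would be a clique, hence a face of too large a dimension. *)
Lemma top_opposite_vertex n s F v : flag D ->
    (forall G, G \in faces D -> #|G| <= n.+1) ->
    (forall G, G \in faces D -> #|G| = n -> 1 < #|tops n.+1 G|) ->
    F \in tops n.+1 s -> v \in F -> v \notin s ->
  exists2 w, ~~ adj v w & w |: (F :\ v) \in tops n.+1 s.
Proof.
move=> flagD dimD ridgeD /topsP[FD Fn sF] vF vs.
have FvD : F :\ v \in faces D := faces_down_closed FD (subsetDl _ _).
have cFv : #|F :\ v| = n by move: (cardsD1 v F); rewrite vF Fn add1n => -[].
have FvF : F \in tops n.+1 (F :\ v) by apply/topsP; split=> //; apply: subsetDl.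
have := ridgeD _ FvD cFv; rewrite (cardsD1 F) FvF ltnS => /card_gt0P[G].
rewrite in_setD1 => /andP[nGF /topsP[GD Gn FvG]].
have : 0 < #|G :\: (F :\ v)| by rewrite cardsD (setIidPr FvG) Gn cFv subSnn.
case/card_gt0P=> w /setDP[wG wFv].
have defG : w |: (F :\ v) = G.
  by apply/eqP; rewrite eqEcard subUset sub1set wG FvG cardsU1 wFv cFv Gn /=.
have nwv : w != v by apply: contraNneq nGF => wv; rewrite -defG wv setD1K.
have wF : w \notin F by move: wFv; rewrite !inE nwv.
exists w; last first.
  rewrite defG; apply/topsP; split=> //; apply: subset_trans FvG.
  by rewrite subsetD1 sF.
apply/negP=> vw; suff /dimD : w |: F \in faces D by rewrite cardsU1 wF Fn ltnn.
apply: clique_face => // x y.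
have wy y' : y' \in F -> adj w y'.
  have [->|ny] := eqVneq y' v; first by rewrite adj_sym.
  by move=> yF; apply: face_adj GD _ _ => //; rewrite -defG !inE ny yF orbT.
case/setU1P=> [->|xF] /setU1P[->|yF]; last exact: face_adj FD _ _.
- exact: face_adj GD _ _.
- exact: wy.
- by rewrite adj_sym; apply: wy.
Qed.

(** F :|: G is a clique, because the vertices of F and G other than v are common
    neighbours of the non-adjacent vertices v and w; it is then a face no larger
    than F and G. *)
Lemma opposite_vertex_inj n s F G v w : flag_no_square D ->
    (forall G, G \in faces D -> #|G| <= n) ->
    F \in tops n s -> G \in tops n s -> v \in F -> v \in G -> ~~ adj v w ->
    w |: (F :\ v) \in faces D -> w |: (G :\ v) \in faces D ->
  F = G.
Proof.
move=> nosqD dimD /topsP[FD Fn sF] /topsP[GD Gn sG] vF vG vw wF wG.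
have nbr H x : H \in faces D -> v \in H -> w |: (H :\ v) \in faces D ->
    x \in H -> adj v x /\ (x != v -> adj w x).
  move=> HD vH wH xH; split; first exact: face_adj HD _ _.
  by move=> nxv; apply: face_adj wH _ _; rewrite !inE ?eqxx // nxv xH orbT.
have nbrU x : x \in F :|: G -> adj v x /\ (x != v -> adj w x).
  by case/setUP; [apply: nbr FD vF wF | apply: nbr GD vG wG].
have UD : F :|: G \in faces D.
  apply: clique_face => [|x y]; first by case: nosqD.
  move=> /nbrU[vx wx] /nbrU[vy wy].
  have [->//|nx] := eqVneq x v; have [->|ny] := eqVneq y v.
    by rewrite adj_sym.
  exact: common_neighbors_adj nosqD vw vx (wx nx) vy (wy ny).
have Un : #|F :|: G| <= n := dimD _ UD.
have /eqP-> : F == F :|: G by rewrite eqEcard subsetUl Fn.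
by apply/esym/eqP; rewrite eqEcard subsetUr Gn.
Qed.

(** Three disjoint families of vertices of the link of s are counted: v itself,
    those of the link of v |: s, which are adjacent to v, and the opposite
    vertices of v in the top faces around v |: s, which are not adjacent to v. *)
Lemma tops_link_vertices_growth n s v : flag_no_square D ->
    (forall G, G \in faces D -> #|G| <= n.+1) ->
    (forall G, G \in faces D -> #|G| = n -> 1 < #|tops n.+1 G|) ->
    v \in tops_link_vertices n.+1 s ->
  #|tops n.+1 (v |: s)| + #|tops_link_vertices n.+1 (v |: s)| + 1
    <= #|tops_link_vertices n.+1 s|.
Proof.
move=> nosqD dimD ridgeD /tops_link_verticesP[vs [F0 F0s vF0]].
have flagD : flag D by case: nosqD.
set P := fun F w => ~~ adj v w && (w |: (F :\ v) \in tops n.+1 s).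
pose opp F := odflt v [pick w | P F w].
have oppP F : F \in tops n.+1 (v |: s) -> P F (opp F).
  rewrite tops_setU1 => /andP[Fs vF]; rewrite /opp; case: pickP => //= noP.
  have [w vw wF] := top_opposite_vertex flagD dimD ridgeD Fs vF vs.
  by have := noP w; rewrite /P vw wF.
have opp_inj : {in tops n.+1 (v |: s) &, injective opp}.
  move=> F G Fs Gs eq_opp; have := oppP G Gs; have := oppP F Fs.
  rewrite -eq_opp => /andP[vw /topsP[FD _ _]] /andP[_ /topsP[GD _ _]].
  move: Fs Gs; rewrite !tops_setU1 => /andP[Fs vF] /andP[Gs vG].
  exact: opposite_vertex_inj nosqD dimD Fs Gs vF vG vw FD GD.
set A := [set opp F | F in tops n.+1 (v |: s)].
set B := tops_link_vertices n.+1 (v |: s).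
have adjB w : w \in v |: B -> adj v w.
  case/setU1P=> [->|/tops_link_verticesP[_ [F]]].
    by case/topsP: F0s => F0D _ _; apply: face_adj F0D _ _.
  by rewrite tops_setU1 => /andP[/topsP[FD _ _] vF] wF; apply: face_adj FD _ _.
have dAB : [disjoint A & v |: B].
  apply/pred0P=> w /=; apply/negP=> /andP[/imsetP[F /oppP/andP[nadj _] ->]].
  by move/adjB; apply/negP.
have vB : v \notin B by rewrite !inE eqxx.
rewrite -addnA addn1 -(card_in_imset opp_inj) -/A.
have -> : #|B|.+1 = #|v |: B| by rewrite cardsU1 vB.
rewrite -cardsUI (disjoint_setI0 dAB) cards0 addn0.
apply/subset_leq_card/subsetP=> w /setUP[/imsetP[F Fs ->]|/setU1P[->|]].
- have /andP[nadj /topsP wF] := oppP F Fs; have [_ _ sF] := wF.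
  apply/tops_link_verticesP; split.
    apply: contra nadj => ws; move: Fs.
    rewrite tops_setU1 => /andP[/topsP[FD _ sF'] vF].
    exact: face_adj FD vF (subsetP sF' _ ws).
  by exists (opp F |: (F :\ v)); [apply/topsP | rewrite !inE eqxx].
- by apply/tops_link_verticesP; split=> //; exists F0.
- case/tops_link_verticesP=> ws [F]; rewrite tops_setU1 => /andP[Fs vF] wF.
  apply/tops_link_verticesP; split; last by exists F.
  by apply: contra ws => ws; rewrite !inE ws orbT.
Qed.

(** * Growth of the face numbers *)

(** Double counting of the pairs (v, F) where F is a top face around s and v is in
    F but not in s. *)
Lemma sum_tops_link n s :
  \sum_(v in tops_link_vertices n s) #|tops n (v |: s)| = (n - #|s|) * #|tops n s|.
Proof.
under eq_bigr => v _ do rewrite -sum1_card.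
rewrite (exchange_big_dep (mem (tops n s))) /=; last first.
  by move=> v F _; rewrite tops_setU1 => /andP[].
rewrite mulnC -sum_nat_const; apply: eq_bigr => F Fs.
case/topsP: (Fs) => FD Fn sF.
have -> : n - #|s| = #|F :\: s| by rewrite cardsD (setIidPr sF) Fn.
rewrite sum1_card; apply: eq_card => v; rewrite [LHS]/in_mem /= tops_setU1 Fs /=.
apply/andP/setDP => [[/tops_link_verticesP[vs _] vF]|[vF vs]] //.
by split=> //; apply/tops_link_verticesP; split=> //; exists F.
Qed.

Lemma face_card_le d F : complex_dim D = d%:Z -> F \in faces D -> #|F| <= d.+1.
Proof.
move=> dimD FD.
have := @leq_bigmax_cond _ (mem (faces D)) (fun F : {set T} => #|F|) F FD.
by move: dimD; rewrite /complex_dim /=; lia.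
Qed.

(** A ridge that is itself a facet is free, so the facets around a ridge all have
    top dimension. *)
Lemma ridge_tops d : complex_dim D = d%:Z -> (forall F, ~~ free_face D F) ->
  forall G, G \in faces D -> #|G| = d -> 1 < #|tops d.+1 G|.
Proof.
move=> dimD nofree G GD Gd.
have maxD := face_card_le dimD.
have := nofree G; rewrite /free_face GD dimD /face_dim Gd eqxx /=.
set Fs := [set F in facets D | G \subset F] => nFs1.
have [M maxM GM] := @maxset_exists _ (fun F => F \in faces D) G GD.
have MFs : M \in Fs by rewrite !inE GM andbT; exact: maxM.
have nFs : 1 < #|Fs|.
  by rewrite ltn_neqAle eq_sym nFs1; apply/card_gt0P; exists M.
apply: leq_trans nFs _; apply/subset_leq_card/subsetP=> F.
rewrite !inE => /andP[/maxsetP[/= FD maxF] GF]; rewrite FD GF andbT /=.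
rewrite eqn_leq maxD //= ltnNge -Gd; apply/negP=> leFG.
have defG : G = F by apply/eqP; rewrite eqEcard GF.
have := nFs1; suff -> : Fs = [set F] by rewrite cards1.
apply/setP=> H; rewrite !inE defG; apply/andP/eqP=> [[/maxsetP[HD _] FH]|->].
  exact: maxF.
by split=> //; apply/maxsetP.
Qed.

(** Uniform lower bounds over the links of dimension m.  They are taken in a field
    because the recursion on m divides by m + 2. *)
Definition link_growth (R : realFieldType) d m (p q : R) : Prop :=
  forall s, #|s| + m = d -> tops d.+1 s != set0 ->
  (p <= #|tops d.+1 s|%:R /\ q <= #|tops_link_vertices d.+1 s|%:R)%R.

Lemma link_growth0 (R : realFieldType) d :
    (forall G, G \in faces D -> #|G| = d -> 1 < #|tops d.+1 G|) ->
  @link_growth R d 0 2%R 2%R.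
Proof.
move=> ridgeD s; rewrite addn0 => sd /set0Pn[F /topsP[FD _ sF]].
have x2 := ridgeD s (faces_down_closed FD sF) sd.
rewrite !ler_nat; split=> //; apply: leq_trans x2 _.
have := sum_tops_link d.+1 s; rewrite sd subSnn mul1n => <-.
rewrite -sum1_card; apply: leq_sum => v; rewrite inE => /andP[vs _].
have vsd : #|v |: s| = d.+1 by rewrite cardsU1 vs sd.
rewrite -(cards1 (v |: s)); apply/subset_leq_card/subsetP=> G /topsP[_ Gd vsG].
by rewrite inE eq_sym eqEcard vsG Gd vsd /=.
Qed.

(** The vertex bound comes from any single vertex of the link of s; summing p over
    all of them, with each top face counted m + 2 times, gives the other bound. *)
Lemma link_growthS (R : realFieldType) d m (p q : R) : flag_no_square D ->
    (forall G, G \in faces D -> #|G| <= d.+1) ->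
    (forall G, G \in faces D -> #|G| = d -> 1 < #|tops d.+1 G|) ->
    (0 <= p)%R -> link_growth d m p q ->
  link_growth d m.+1 (p * (p + q + 1) / m.+2%:R)%R (p + q + 1)%R.
Proof.
move=> nosqD dimD ridgeD p0 grow s sd tops_s.
have growv v : v \in tops_link_vertices d.+1 s ->
    (p <= #|tops d.+1 (v |: s)|%:R /\
     q <= #|tops_link_vertices d.+1 (v |: s)|%:R)%R.
  by rewrite inE => /andP[vs ?]; apply: grow; rewrite // cardsU1 vs; lia.
have y_ge : (p + q + 1 <= #|tops_link_vertices d.+1 s|%:R)%R.
  case/set0Pn: tops_s => F Fs; case/topsP: (Fs) => FD Fn sF.
  have /card_gt0P[v /setDP[vF vs]] : 0 < #|F :\: s|.
    by rewrite cardsD (setIidPr sF) Fn; lia.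
  have vL : v \in tops_link_vertices d.+1 s.
    by apply/tops_link_verticesP; split=> //; exists F.
  have := tops_link_vertices_growth nosqD dimD ridgeD vL.
  rewrite -(ler_nat R) !natrD; apply: le_trans.
  by have [? ?] := growv v vL; rewrite lerD2r lerD.
split=> //; rewrite ler_pdivrMr ?ltr0n //.
apply: (le_trans (ler_wpM2l p0 y_ge)).
have -> : m.+2 = d.+1 - #|s| by lia.
rewrite mulrC -natrM mulnC -sum_tops_link natr_sum -sumr_const big_distrl /=.
by apply: ler_sum => v vL; rewrite mul1r; case: (growv v vL).
Qed.

Lemma link_growthW (R : realFieldType) d m (p q p' q' : R) :
  (p' <= p)%R -> (q' <= q)%R -> link_growth d m p q -> link_growth d m p' q'.
Proof.
move=> pp qq grow s sd /(grow s sd)[? ?].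
by split; [apply: le_trans pp _ | apply: le_trans qq _].
Qed.

(** The factor k + 5 absorbs the division by k + 4 in the recursion, since
    (k + 5) ^ 2 >= (k + 4) (k + 6).  The vertex bound is dropped: only
    x_(m+1) >= x_m ^ 2 / (m + 2) is used. *)
Lemma link_growth_exp (R : realFieldType) d k : flag_no_square D ->
    (forall G, G \in faces D -> #|G| <= d.+1) ->
    (forall G, G \in faces D -> #|G| = d -> 1 < #|tops d.+1 G|) ->
    @link_growth R d 2 (55 / 3)%R 11%R ->
  @link_growth R d k.+2 ((k + 5)%:R * (25 / 12) ^+ (2 ^ k))%R 0%R.
Proof.
move=> nosqD dimD ridgeD grow2; elim: k => [|k IHk].
  by apply: link_growthW grow2; rewrite ?expn0 ?expr1; lra.
set p := (_ * _)%R in IHk.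
have p0 : (0 <= p)%R by rewrite mulr_ge0 // exprn_ge0 //; lra.
apply: link_growthW (link_growthS nosqD dimD ridgeD p0 IHk); last by lra.
rewrite addr0 ler_pdivlMr ?ltr0n //.
apply: (@le_trans _ _ (p * p)%R); last by rewrite ler_wpM2l // lerDl.
rewrite /p expnS mulnC exprM expr2.
set z := (_ ^+ (2 ^ k))%R; have z0 : (0 <= z)%R by rewrite exprn_ge0 //; lra.
rewrite [leLHS]mulrAC [leRHS]mulrACA ler_wpM2r ?mulr_ge0 // -!natrM ler_nat; nia.
Qed.

End FlagNoSquare.

(** * The bounds in terms of real powers *)

(** For the dimensions at most 2, where the exponents of the theorem can be
    negative powers of 2. *)
Lemma powR_25_12_lt2 (R : realType) k :
  (25 / 12 : R) `^ (2 ^ (- k.+1%:Z)) < 2.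
Proof.
apply: (@le_lt_trans _ _ ((25 / 12 : R) `^ 2^-1)).
  apply: ler_powR; first by lra.
  rewrite -exprnN exprS invfM ler_piMr ?invr_ge0 // invf_le1 ?exprn_gt0 //.
  by rewrite exprn_ege1 // ler1n.
rewrite powR12_sqrt; last by lra.
have -> : (2 : R) = Num.sqrt (2 ^+ 2) by rewrite sqrtr_sqr ger0_norm.
by rewrite ltr_sqrt; lra.
Qed.

Theorem theorem8 (R : realType) (T : finType) (D : simplicial_complex T)
    (d : nat)
    (hdim : complex_dim D = d%:Z)
    (hflag : flag_no_square D)
    (hfree : forall F : {set T}, ~~ free_face D F) :
  (25 / 12 : R) `^ ((2 : R) ^ (d%:Z - 2)) < (f_vector D d%:Z)%:R /\
  (25 / 12 : R) `^ ((2 : R) ^ (d%:Z - 3)) < (f_vector D 0)%:R.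
Proof.
have ridgeD := ridge_tops hdim hfree.
have dimD := face_card_le hdim.
have f_d : f_vector D d%:Z = #|tops D d.+1 set0|.
  apply: eq_card => F; rewrite !inE sub0set andbT /face_dim.
  by congr (_ && _); apply/eqP/eqP; lia.
have f_0 : (#|tops_link_vertices D d.+1 set0| <= f_vector D 0)%N.
  rewrite -(card_imset _ set1_inj); apply/subset_leq_card/subsetP=> F.
  case/imsetP=> v /tops_link_verticesP[_ [G /topsP[GD _ _] vG]] ->.
  by rewrite !inE /face_dim cards1 subrr eqxx andbT (faces_down_closed GD) ?sub1set.
have tops0 : tops D d.+1 set0 != set0.
  have [x xD] := faces_vertex D.
  have D0 : (0 < #|faces D|)%N by apply/card_gt0P; exists [set x].
  have [F FD maxF] := eq_bigmax_cond (fun F : {set T} => #|F|) D0.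
  apply/set0Pn; exists F; apply/topsP; split=> //; last exact: sub0set.
  by move: hdim; rewrite /complex_dim maxF; lia.
have f_ge p q : link_growth D d d p q ->
    p <= (f_vector D d%:Z)%:R /\ q <= (f_vector D 0)%:R :> R.
  move=> /(_ set0)[]; rewrite ?cards0 // => pf qf; rewrite f_d; split=> //.
  by apply: le_trans qf _; rewrite ler_nat.
have grow0 := link_growth0 R ridgeD.
have grow1 : link_growth D d 1 (5 : R) 5.
  by apply: link_growthW (link_growthS hflag dimD ridgeD _ grow0) => //; lra.
have grow2 : link_growth D d 2 (55 / 3 : R) 11.
  by apply: link_growthW (link_growthS hflag dimD ridgeD _ grow1) => //; lra.
have growk k := @link_growth_exp _ _ R d k hflag dimD ridgeD grow2.
have exp_nat k : (25 / 12 : R) `^ (2 ^ k%:Z) = (25 / 12) ^+ (2 ^ k).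
  by rewrite -exprnP -natrX powR_mulrn //; lra.
have exp_lt k : (25 / 12 : R) ^+ (2 ^ k) < (k + 5)%:R * (25 / 12) ^+ (2 ^ k).
  have B0 : 0 < (25 / 12 : R) by lra.
  by rewrite (ltr_pMl _ (exprn_gt0 _ B0)) ltr1n !addnS.
have small := powR_25_12_lt2 R.
have [d0|d1|d2|[k dk]] : [\/ d = 0%N, d = 1%N, d = 2%N | exists k, d = k.+3].
  case: (d) => [|[|[|k]]]; [exact: Or41 | exact: Or42 | exact: Or43 |].
  by apply: Or44; exists k.
- have [fd f0] := f_ge 2 2 ltac:(by rewrite {2}d0).
  rewrite d0 in fd *; rewrite !sub0r.
  by split; [apply: lt_le_trans (small 1%N) fd | apply: lt_le_trans (small 2%N) f0].
- have [fd f0] := f_ge 5 5 ltac:(by rewrite {2}d1).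
  rewrite d1 in fd *; rewrite (_ : 1%:Z - 2 = - 1%:Z) // (_ : 1%:Z - 3 = - 2%:Z) //.
  by have := small 0%N; have := small 1%N; lra.
- have [fd f0] := f_ge (55 / 3) 11 ltac:(by rewrite {2}d2).
  rewrite d2 in fd *; rewrite subrr (_ : 2%:Z - 3 = - 1%:Z) // expr0z powRr1;
    last by lra.
  by have := small 0%N; lra.
have -> : d%:Z - 2 = k.+1%:Z by lia.
have -> : d%:Z - 3 = k%:Z by lia.
rewrite !exp_nat.
have [fd _] := f_ge _ _ ltac:(rewrite {2}dk; exact: growk k.+1).
split; first exact: lt_le_trans (exp_lt k.+1) fd.
have := growk k; set p := (_ * _) => growp.
have p0 : 0 <= p by rewrite mulr_ge0 // exprn_ge0 //; lra.
have growSp := link_growthS hflag dimD ridgeD p0 growp.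
have [_ f0] := f_ge _ _ ltac:(rewrite {2}dk; exact: growSp).
by have := exp_lt k; rewrite -/p; lra.
Qed.
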